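(* For every $n\ge 1$, the poset $\Pi^A_{n,1}$ is CL-shellable and Cohen-Macaulay.
   Context: Write $[n]=\{1,\dots,n\}$. A pointed partition of $[n]$ is a partition of $[n]$ into non-empty blocks together with the choice of one element in each block, called the pointed element of this block. The poset $\Pi^A_n$ is the set of all pointed partitions of $[n]$, with $\pi\le\nu$ if and only if the underlying partition of $\pi$ refines that of $\nu$ and the set of pointed elements of $\pi$ contains the set of pointed elements of $\nu$. Its minimal element $\hat 0$ is the partition into singletons, and its maximal elements are the $n$ one-block partitions with one pointed element. All maximal intervals $[\hat 0,\alpha]$ ($\alpha$ maximal) are isomorphic; $\Pi^A_{n,1}$ denotes such an interval (for instance the set of pointed partitions in which $1$ is pointed). CL-shellable (Björner–Wachs): a finite bounded poset $P$ in which all maximal chains have the same length is CL-shellable if it admits a CL-labelling, i.e. a labelling which assigns to every pair (maximal chain $m$ of $P$, edge of $m$) an element of some totally (or partially) ordered set, such that (1) if two maximal chains coincide along their first $d$ edges, then their labels coincide along these edges; (2) for every interval $[x,y]$ and every unrefinable chain $r$ from $\hat 0$ to $x$, there is a unique maximal chain of $[x,y]$ whose label sequence (computed with root $r$) is increasing, and this label sequence lexicographically precedes those of all other maximal chains of $[x,y]$. Cohen-Macaulay: for $\mathbb{K}$ the ring $\mathbb{Z}$ or any field, for every $x<y$ in the poset the reduced homology with coefficients in $\mathbb{K}$ of the order complex of the open interval $(x,y)$ vanishes except possibly in top degree $\ell-2$, where $\ell$ is the length of $[x,y]$. *)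

(* Defs.v *)
From HB Require Import structures.
From mathcomp Require Import all_boot all_order all_algebra.

Set Implicit Arguments.
Unset Strict Implicit.
Unset Printing Implicit Defensive.

Import Order.Theory GRing.Theory.

Local Open Scope order_scope.

Section PointedPartitions.
Variable n : nat.

(* The ground set [n] is 'I_n. The chosen elements, one in each block, are    *)
(* recorded as a transversal of the partition.                                *)
Record pointed_partition := PointedPartition {
  pp_val : {set {set 'I_n}} * {set 'I_n};
  _ : is_transversal pp_val.2 pp_val.1 [set: 'I_n] }.

HB.instance Definition _ := [isSub for pp_val].
HB.instance Definition _ := [Finite of pointed_partition by <:].

Definition blocks (p : pointed_partition) : {set {set 'I_n}} := (pp_val p).1.
Definition points (p : pointed_partition) : {set 'I_n} := (pp_val p).2.

Definition refines (P Q : {set {set 'I_n}}) : bool :=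
  [forall B in P, exists C in Q, B \subset C].

Definition pp_le (p q : pointed_partition) : bool :=
  refines (blocks p) (blocks q) && (points q \subset points p).

Lemma refinesP (P Q : {set {set 'I_n}}) :
  reflect (forall B, B \in P -> exists2 C, C \in Q & B \subset C)
          (refines P Q).
Proof.
apply: (iffP forall_inP) => h B /h; first by move/exists_inP.
by move=> ?; apply/exists_inP.
Qed.

Lemma blocks_partition p : partition (blocks p) [set: 'I_n].
Proof. by case: p => v hv; case/and3P: (hv). Qed.

Lemma refines_refl P : refines P P.
Proof. by apply/refinesP => B hB; exists B. Qed.

Lemma refines_trans P Q R : refines P Q -> refines Q R -> refines P R.
Proof.
move=> /refinesP PQ /refinesP QR; apply/refinesP => B /PQ[C /QR[D hD CD] BC].
by exists D => //; apply: subset_trans CD.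
Qed.

Lemma refines_sub P Q :
    partition P [set: 'I_n] -> refines P Q -> refines Q P -> P \subset Q.
Proof.
case/and3P=> _ /trivIsetP tP P0 /refinesP PQ /refinesP QP.
apply/subsetP => B hB; have [C hC BC] := PQ _ hB; have [D hD CD] := QP _ hC.
have BD : B = D.
  apply/eqP/negPn/negP => /(tP _ _ hB hD).
  rewrite -setI_eq0 (setIidPl (subset_trans BC CD)) => /eqP B0.
  by move: P0; rewrite -B0 hB.
by have -> : B = C; [apply/eqP; rewrite eqEsubset BC BD CD | ].
Qed.

Lemma pp_le_refl : reflexive pp_le.
Proof. by move=> p; rewrite /pp_le refines_refl subxx. Qed.

Lemma pp_le_anti : antisymmetric pp_le.
Proof.
move=> p q /andP[/andP[pq qp'] /andP[qp pq']].
apply: val_inj; apply/eqP; rewrite [val p]surjective_pairing.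
rewrite [val q]surjective_pairing xpair_eqE !eqEsubset.
by rewrite (refines_sub (blocks_partition p) pq qp)
           (refines_sub (blocks_partition q) qp pq) /= pq' qp'.
Qed.

Lemma pp_le_trans : transitive pp_le.
Proof.
move=> q p r /andP[pq qp'] /andP[qr rq']; apply/andP; split.
  exact: refines_trans pq qr.
exact: subset_trans rq' qp'.
Qed.

Fact pp_display : Order.disp_t. Proof. exact: Order.Disp tt tt. Qed.

HB.instance Definition _ := Order.Le_isPOrder.Build pp_display
  pointed_partition pp_le_refl pp_le_anti pp_le_trans.

Definition discrete : {set {set 'I_n}} := [set [set i] | i in 'I_n].

Fact discrete_transversal :
  is_transversal (discrete, [set: 'I_n]).2 (discrete, [set: 'I_n]).1
                 [set: 'I_n].
Proof.
rewrite /is_transversal subxx /=; apply/andP; split; last first.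
  by apply/forall_inP => B /imsetP[i _ ->]; rewrite setTI cards1.
apply/and3P; split.
- rewrite eqEsubset subsetT; apply/subsetP => i _.
  by apply/bigcupP; exists [set i]; rewrite ?set11 ?imset_f.
- apply/trivIsetP => _ _ /imsetP[i _ ->] /imsetP[j _ ->] ij.
  by rewrite disjoints1 inE; apply: contraNneq ij => ->.
- by apply/imsetP => -[i _ /setP/(_ i)]; rewrite !inE eqxx.
Qed.

Definition pp_bottom := PointedPartition discrete_transversal.

Lemma pp_bottom_le p : pp_bottom <= p.
Proof.
rewrite /Order.le /= /pp_le subsetT andbT; apply/refinesP => _ /imsetP[i _ ->].
have := in_setT i; rewrite -(cover_partition (blocks_partition p)).
by case/bigcupP=> B hB iB; exists B; rewrite ?sub1set.
Qed.

HB.instance Definition _ :=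
  Order.hasBottom.Build pp_display pointed_partition pp_bottom_le.

End PointedPartitions.

(* The interval [\bot, a] as a bounded poset in its own right. *)
Section LowerInterval.
Variables (d : Order.disp_t) (T : finBPOrderType d) (a : T).

Definition lower_interval := {z : T | \bot <= z <= a}.

HB.instance Definition _ := SubFinite.on lower_interval.
HB.instance Definition _ :=
  [SubChoice_isSubPOrder of lower_interval by <: with d].

Fact bot_in_interval : \bot <= (\bot : T) <= a.
Proof. by rewrite lexx le0x. Qed.

Fact top_in_interval : \bot <= a <= a.
Proof. by rewrite lexx le0x. Qed.

Lemma interval_bot_le (z : lower_interval) :
  (exist _ \bot bot_in_interval : lower_interval) <= z.
Proof. by rewrite leEsub /= le0x. Qed.

Lemma interval_le_top (z : lower_interval) :
  z <= (exist _ a top_in_interval : lower_interval).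
Proof. by rewrite leEsub /=; case/andP: (valP z). Qed.

HB.instance Definition _ :=
  Order.hasBottom.Build d lower_interval interval_bot_le.
HB.instance Definition _ := Order.hasTop.Build d lower_interval interval_le_top.

End LowerInterval.

Definition maximal (d : Order.disp_t) (T : porderType d) (a : T) : Prop :=
  forall b : T, a <= b -> b = a.

Section CLShellability.
Variables (d : Order.disp_t) (P : finTBPOrderType d).
Implicit Types (x y : P) (m r c t : seq P).

Definition covers x y : bool := (x < y) && [forall z, ~~ (x < z < y)].

(* Unrefinable chains from x to y, i.e. maximal chains of [x, y]; the chain   *)
(* x = x_0 < x_1 < ... < x_k = y is encoded by the sequence x_1, ..., x_k.    *)
Definition unrefinable x y c : bool := path covers x c && (last x c == y).

Definition maximal_chain m : bool := unrefinable \bot \top m.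

Definition pure_poset : Prop :=
  forall m m', maximal_chain m -> maximal_chain m' -> size m = size m'.

Section Labelling.
(* lam m i is the label, with respect to the maximal chain m, of the i-th     *)
(* edge x_i < x_(i+1) of m; only its values for m a maximal chain and         *)
(* i < size m are relevant.                                                   *)
Variables (dL : Order.disp_t) (L : porderType dL) (lam : seq P -> nat -> L).

Definition chain_compatible : Prop :=
  forall m m' k, maximal_chain m -> maximal_chain m' ->
    (k <= size m)%N -> (k <= size m')%N ->
    take k m = take k m' ->
    forall i, (i < k)%N -> lam m i = lam m' i.

(* Labels of the edges of c in the maximal chain r ++ c ++ t. For a chain-    *)
(* compatible labelling these do not depend on t.                             *)
Definition rooted_labels r c t : seq L :=
  [seq lam (r ++ c ++ t) i | i <- iota (size r) (size c)].

(* "Increasing" is read strictly. Replacing the label l of the i-th edge by   *)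
(* (l, i), resp. (l, - i), ordered lexicographically, turns a labelling for   *)
(* the weak reading into one for the strict reading, resp. conversely.        *)
Definition increasing_chain_property : Prop :=
  forall x y r t, x <= y ->
    unrefinable \bot x r -> unrefinable y \top t ->
    exists c,
      [/\ unrefinable x y c,
          sorted <%O (rooted_labels r c t),
          forall c', unrefinable x y c' ->
            sorted <%O (rooted_labels r c' t) -> c' = c
        & forall c', unrefinable x y c' -> c' != c ->
            (rooted_labels r c t : seqlexi L) < rooted_labels r c' t].

Definition CL_labelling : Prop :=
  chain_compatible /\ increasing_chain_property.

End Labelling.

Definition CL_shellable : Prop :=
  pure_poset /\
  exists (dL : Order.disp_t) (L : porderType dL) (lam : seq P -> nat -> L),
    CL_labelling lam.

End CLShellability.

Section CohenMacaulay.
Variables (d : Order.disp_t) (P : finPOrderType d).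

Definition is_chain (s : {set P}) : bool :=
  [forall x in s, forall y in s, x >=< y].

(* The empty chain is a face, so that the homology below is reduced. *)
Definition order_complex (A : {set P}) : {set {set P}} :=
  [set s in powerset A | is_chain s].

Definition open_interval (x y : P) : {set P} := [set z | x < z < y].

Definition interval_length (x y : P) : nat :=
  (\max_(s : {set P} | is_chain s && (s \subset [set z | (x <= z <= y)%O]))
      #|s|.-1)%N.

Section Homology.
Variables (R : comNzRingType) (D : {set {set P}}).
Local Open Scope ring_scope.

(* Simplicial chains of degree k - 1: combinations of faces with k vertices.  *)
Definition simplicial_chain (k : nat) (f : {ffun {set P} -> R}) : Prop :=
  forall s, f s != 0 -> s \in D /\ #|s| = k.

(* The linear extension of                                                    *)
(*   {x_0 < ... < x_k} |-> \sum_i (-1)^i {x_0 < ... < x_k} \ {x_i},           *)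
(* including the augmentation {x_0} |-> set0.                                 *)
Definition boundary (f : {ffun {set P} -> R}) : {ffun {set P} -> R} :=
  [ffun t => \sum_(s : {set P}) \sum_(v in s | s :\ v == t)
     (-1) ^+ #|[set z in s | (z < v)%O]| * f s].

(* Vanishing of the reduced homology of D in degree k - 1 (k = 0: degree -1). *)
Definition homology_vanishes (k : nat) : Prop :=
  forall f, simplicial_chain k f -> boundary f = 0 ->
    exists2 g, simplicial_chain k.+1 g & boundary g = f.

End Homology.

(* Degree k - 1 differs from the top degree l - 2 iff k.+1 <> l. *)
Definition Cohen_Macaulay_over (R : comNzRingType) : Prop :=
  forall x y : P, x < y -> forall k : nat, k.+1 <> interval_length x y ->
    homology_vanishes R (order_complex (open_interval x y)) k.

Definition Cohen_Macaulay : Prop :=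
  Cohen_Macaulay_over int /\ forall K : fieldType, Cohen_Macaulay_over K.

End CohenMacaulay.

(* Main.v *)
(* A pointed partition of [n] is the same thing as an idempotent self-map of [n], sending each
   element to the point of its block; the order becomes f <= g iff g f = g = f g, and a cover of
   f redirects the elements sent to a point b towards another point a.  With this description
   one checks that the poset is graded and totally semimodular: two distinct covers u, v of z
   below y are both covered by some w <= y.

   For a graded totally semimodular poset, chain labels are built along the chain so that the
   atoms above x covering an atom that precedes x come first, with smaller labels than x; then
   the greedy chain is the only increasing one.  For the homology of ]x, y[, add the atoms one
   at a time: the part above a new atom a is a cone, and by semimodularity it meets what was
   already there in the part of ]a, y[ generated by some of the atoms of [a, y], so that
   Mayer-Vietoris applies by induction on the length. *)
Require Import Defs.
From mathcomp Require Import all_boot all_order all_algebra.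
From mathcomp Require Import zify.

Set Implicit Arguments.
Unset Strict Implicit.
Unset Printing Implicit Defensive.

Import Order.Theory GRing.Theory Num.Theory.
Local Open Scope order_scope.

(** * Reduced simplicial chains of order complexes: boundary, cones, Mayer-Vietoris *)

Section Chains.
Variables (d : Order.disp_t) (P : finPOrderType d) (R : comNzRingType).
Implicit Types (f g : {ffun {set P} -> R}) (s t A B : {set P}) (a v w z : P).
Local Open Scope ring_scope.

Lemma is_chainP s :
  reflect {in s &, forall v w, (v >=< w)%O} (is_chain s).
Proof.
apply: (iffP forall_inP) => h v; last by move=> vs; apply/forall_inP => w; apply: h.
by move=> w /h/forall_inP; apply.
Qed.

Lemma is_chainS s t : s \subset t -> is_chain t -> is_chain s.
Proof.
by move=> /subsetP st /is_chainP ct; apply/is_chainP => v w /st vt /st; apply: ct.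
Qed.

Lemma in_order_complex A s : (s \in order_complex A) = (s \subset A) && is_chain s.
Proof. by rewrite !inE. Qed.

Local Notation below v t := #|[set z in t | (z < v)%O]|.

(** The boundary read coface by coface; the sign may be counted in [t] because [v] is not below
    itself. *)
Lemma boundaryE f t :
  boundary f t = \sum_(v | v \notin t) (-1) ^+ below v t * f (v |: t).
Proof.
rewrite ffunE (exchange_big_dep xpredT) //= [RHS]big_mkcond /=.
apply: eq_bigr => v _; case: ifPn => [vt|/negPn vt]; last first.
  by apply: big_pred0 => s; apply/negP => /andP[_ /eqP e]; rewrite -e !inE eqxx in vt.
rewrite (big_pred1 (v |: t)) => [|s /=].
  congr (_ ^+ #|pred_of_set _| * _); apply/setP => z; rewrite !inE.
  by case: eqP => // ->; rewrite ltxx !andbF.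
apply/andP/eqP => [[vs /eqP <-]|->]; first by rewrite setD1K.
by rewrite setU11 setU1K.
Qed.

Lemma boundaryD f g : boundary (f + g) = boundary f + boundary g.
Proof.
apply/ffunP => t; rewrite [RHS]ffunE !boundaryE -big_split.
by apply: eq_bigr => v _; rewrite ffunE mulrDr.
Qed.

Lemma boundaryN f : boundary (- f) = - boundary f.
Proof.
apply/ffunP => t; rewrite [RHS]ffunE !boundaryE -sumrN.
by apply: eq_bigr => v _; rewrite ffunE mulrN.
Qed.

Lemma boundary0 : boundary 0 = 0 :> {ffun {set P} -> R}.
Proof.
apply/ffunP => t; rewrite boundaryE [RHS]ffunE.
by apply: big1 => v _; rewrite ffunE mulr0.
Qed.

Lemma below_setU1l v w t : (v < w)%O -> v \notin t ->
  below w (v |: t) = (below w t).+1.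
Proof.
move=> vw vt; rewrite [LHS](cardsD1 v) !inE eqxx vw add1n; congr _.+1.
apply: eq_card => z; rewrite !inE.
by case: eqP => //= ->; rewrite (negPf vt).
Qed.

Lemma below_setU1r v w t : ~~ (w < v)%O -> below v (w |: t) = below v t.
Proof.
move=> wv; apply: eq_card => z; rewrite !inE.
by case: eqP => //= ->; rewrite (negPf wv) andbF.
Qed.

(** For [v < w], adding [v] and [w] to [t] in the two orders gives opposite signs: [v] counts below
    [w], but not conversely. Incomparable pairs would have equal signs; support on chains removes
    them. *)
Lemma boundaryK f :
  (forall s, f s != 0 -> is_chain s) -> boundary (boundary f) = 0.
Proof.
move=> cf; apply/ffunP => t; rewrite boundaryE [RHS]ffunE.
pose T v w := if (v \notin t) && (w \notin v |: t) then
  (-1) ^+ below v t * ((-1) ^+ below w (v |: t) * f (w |: (v |: t))) else 0.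
have -> : \sum_(v | v \notin t) (-1) ^+ below v t * boundary f (v |: t) =
    \sum_v \sum_w T v w.
  rewrite big_mkcond; apply: eq_bigr => v _; rewrite /T.
  case: ifP => _ /=; last by rewrite big1.
  by rewrite boundaryE mulr_sumr big_mkcond.
have T0 v w : ~~ (v < w)%O -> ~~ (w < v)%O -> T v w = 0.
  move=> vw wv; rewrite /T; case: ifP => // /andP[vt].
  rewrite !inE negb_or => /andP[nwv wt].
  have [->|/cf/is_chainP/(_ v w)] := eqVneq (f (w |: (v |: t))) 0.
    by rewrite !mulr0.
  rewrite !inE !eqxx orbT => /(_ isT isT).
  by rewrite /Order.comparable !le_eqVlt (negPf vw) (negPf wv) eq_sym (negPf nwv).
have -> : \sum_v \sum_w T v w =
   \sum_v \sum_(w | (v < w)%O) T v w + \sum_v \sum_(w | (w < v)%O) T v w.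
  rewrite -big_split; apply: eq_bigr => v _ /=.
  rewrite [X in _ = X + _]big_mkcond [X in _ = _ + X]big_mkcond -big_split.
  apply: eq_bigr => w _ /=; case: ifPn => vw.
    by rewrite (lt_gtF vw) addr0.
  by case: ifPn => wv; rewrite add0r // T0.
rewrite [X in _ + X](exchange_big_dep xpredT) //= -big_split big1 // => v _.
rewrite -big_split big1 // => w vw; rewrite /T !inE !negb_or.
rewrite [w == v]eq_sym (lt_eqF vw) /= [(w \notin t) && _]andbC.
case: ifP => [/andP[vt wt]|_]; last exact: addr0.
have wv : ~~ (w < v)%O by rewrite lt_gtF.
rewrite (below_setU1l vw vt) (below_setU1r t wv) setUCA exprS mulN1r mulNr mulrN mulrCA.
exact: addNr.
Qed.

Lemma simplicial_chainD (D : {set {set P}}) k f g :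
  simplicial_chain D k f -> simplicial_chain D k g -> simplicial_chain D k (f + g).
Proof.
move=> sf sg s; rewrite ffunE; have [->|/sf //] := eqVneq (f s) 0.
by rewrite add0r => /sg.
Qed.

Lemma simplicial_chainN (D : {set {set P}}) k f :
  simplicial_chain D k f -> simplicial_chain D k (- f).
Proof. by move=> sf s; rewrite ffunE oppr_eq0 => /sf. Qed.

Lemma simplicial_chain_boundary A k f :
  simplicial_chain (order_complex A) k.+1 f ->
  simplicial_chain (order_complex A) k (boundary f).
Proof.
move=> sf t; rewrite boundaryE.
have [v /andP[vt]|f0] := pickP [pred v | (v \notin t) && (f (v |: t) != 0)].
  case/sf; rewrite !in_order_complex cardsU1 vt => /andP[vA vc] [<-] _.
  by rewrite (subset_trans (subsetU1 v t) vA) (is_chainS (subsetU1 v t) vc).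
rewrite big1 ?eqxx // => v vt.
by have := f0 v; rewrite /= vt => /negbFE/eqP->; rewrite mulr0.
Qed.

Lemma simplicial_chainS A B k f : A \subset B ->
  simplicial_chain (order_complex A) k f -> simplicial_chain (order_complex B) k f.
Proof.
move=> AB sf s /sf; rewrite !in_order_complex => -[/andP[sA ->] ->].
by rewrite (subset_trans sA).
Qed.

Definition cone a f : {ffun {set P} -> R} :=
  [ffun s : {set P} => if a \in s then f (s :\ a) else 0].

Lemma coneE a f s : cone a f s = if a \in s then f (s :\ a) else 0.
Proof. by rewrite ffunE. Qed.

(** Deleting the least vertex [a] gives [f] back with sign +1; every other sign is shifted by one,
    since [a] lies below the deleted vertex. *)
Lemma boundary_cone a f :
    (forall s, f s != 0 -> {in s, forall z, (a < z)%O}) ->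
  boundary (cone a f) = f - cone a (boundary f).
Proof.
move=> af; apply/ffunP => t; rewrite boundaryE [RHS]ffunE [X in _ + X]ffunE coneE.
case: ifPn => [ta|ta]; last first.
  rewrite subr0 (bigD1 a) //= big1 ?addr0 => [|v /andP[vt va]]; last first.
    by rewrite coneE !inE eq_sym (negPf va) (negPf ta) mulr0.
  rewrite coneE setU11 setU1K //.
  have [->|/af atz] := eqVneq (f t) 0; first by rewrite mulr0.
  rewrite (_ : below a t = 0) ?mul1r //; apply/eqP; rewrite cards_eq0 -subset0.
  apply/subsetP => z; rewrite !inE => /andP[/atz/lt_gtF->] //.
have -> : f t = 0.
  by apply/eqP; apply: contraTT isT => /af/(_ _ ta); rewrite ltxx.
rewrite boundaryE add0r [in RHS](bigD1 a) ?setD11 //= setD1K //.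
have -> : f t = 0.
  by apply/eqP; apply: contraTT isT => /af/(_ _ ta); rewrite ltxx.
rewrite mulr0 add0r -sumrN; apply: eq_big => v.
  by rewrite !inE negb_and negbK; case: eqP => [->|_]; rewrite ?ta ?andbT.
move=> vt; have va : v != a by apply: contraNneq vt => ->.
rewrite coneE !inE ta orbT.
have -> : (v |: t) :\ a = v |: (t :\ a).
  by apply/setP => z; rewrite !inE; case: eqP => // ->; rewrite eq_sym (negPf va).
have [->|/af/(_ v)] := eqVneq (f (v |: t :\ a)) 0; first by rewrite !mulr0 oppr0.
rewrite setU11 => /(_ isT) av.
by rewrite -{1}(setD1K ta) below_setU1l ?inE ?eqxx // exprS mulN1r mulNr.
Qed.

(** A cycle [f] is filled by the join of [a] with its part [f0] on the faces avoiding [a]: the cycle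
    equation at [s :\ a] recovers [f s] from [f0] when [a] is in [s]. *)
Lemma homology_vanishes_cone A a k :
    a \in A -> {in A, forall z, (a <= z)%O} ->
  homology_vanishes R (order_complex A) k.
Proof.
move=> aA Aa f sf bf.
have aS t s : s \subset A -> a \notin s -> {in s, forall z, (a < z)%O}.
  move=> /subsetP sA as' z zs; rewrite lt_neqAle Aa ?sA // andbT.
  by apply: contraNneq as' => ->.
pose f0 : {ffun {set P} -> R} := [ffun s : {set P} => if a \in s then 0 else f s].
have f0a s : f0 s != 0 -> {in s, forall z, (a < z)%O}.
  rewrite ffunE; case: ifPn; rewrite ?eqxx // => as' /sf[].
  by rewrite in_order_complex => /andP[sA _] _; apply: aS.
exists (cone a f0).
  move=> s; rewrite coneE ffunE; case: ifPn; rewrite ?eqxx // => sa.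
  rewrite !inE eqxx /= => /sf; rewrite !in_order_complex => -[/andP[sA sc] <-].
  have sA' : s \subset A.
    by rewrite -(setD1K sa) subUset sub1set aA.
  rewrite sA' [in #|s|](cardsD1 a) sa; split=> //; apply/is_chainP => v w vs ws.
  have [->|va] := eqVneq v a.
    by rewrite /Order.comparable Aa ?(subsetP sA').
  have [->|wa] := eqVneq w a.
    by rewrite comparable_sym /Order.comparable Aa ?(subsetP sA').
  by apply: (is_chainP _ sc); rewrite !inE ?va ?wa.
rewrite boundary_cone //; apply/ffunP => s.
rewrite [LHS]ffunE [X in _ + X]ffunE coneE [f0 s]ffunE.
case: ifPn => [sa|sa]; last by rewrite subr0.
have /eqP := congr1 (fun g : {ffun {set P} -> R} => g (s :\ a)) bf.
rewrite [X in _ == X]ffunE [X in X == _]boundaryE.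
rewrite [X in X == _](bigD1 a) ?setD11 //= setD1K // addr_eq0 => /eqP e.
have sa1 : (-1) ^+ below a (s :\ a) * f s = f s.
  have [->|/sf[]] := eqVneq (f s) 0; first by rewrite mulr0.
  rewrite in_order_complex => /andP[sA _] _.
  rewrite (_ : below a _ = 0)%N ?mul1r //; apply/eqP.
  rewrite cards_eq0 -subset0; apply/subsetP => z; rewrite !inE.
  by move=> /andP[/andP[_ /(subsetP sA)/Aa/le_gtF->]].
rewrite sa1 in e; rewrite e add0r; congr (- _); rewrite boundaryE.
rewrite [LHS](bigID (pred1 a)) /= [X in X + _]big1 ?add0r => [|v /andP[_ /eqP->]].
  apply: eq_bigr => v /andP[_ va].
  by rewrite [f0 _]ffunE !inE eqxx eq_sym (negPf va).
by rewrite [f0 _]ffunE setU11 mulr0.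
Qed.

(** Cut the cycle [f] into [f1] on the faces in [A] and [f2] on the others. Then
    [boundary f1 = - boundary f2] is a cycle of the intersection, bounded there by some [h], and the
    cycles [f1 - h] and [f2 + h] are filled in [A] and in [B]. *)
Lemma Mayer_Vietoris (U A B : {set P}) k :
    A \subset U -> B \subset U ->
    (forall s, is_chain s -> s \subset U -> (s \subset A) || (s \subset B)) ->
    homology_vanishes R (order_complex A) k.+1 ->
    homology_vanishes R (order_complex B) k.+1 ->
    homology_vanishes R (order_complex (A :&: B)) k ->
  homology_vanishes R (order_complex U) k.+1.
Proof.
move=> AU BU cover hA hB hAB f sf bf.
pose f1 : {ffun {set P} -> R} := [ffun s : {set P} => if s \subset A then f s else 0].
pose f2 : {ffun {set P} -> R} := [ffun s : {set P} => if s \subset A then 0 else f s].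
have ef : f = f1 + f2.
  by apply/ffunP => s; rewrite !ffunE; case: ifP; rewrite ?addr0 ?add0r.
have sf1 : simplicial_chain (order_complex A) k.+1 f1.
  move=> s; rewrite ffunE; case: ifPn; rewrite ?eqxx // => sA /sf.
  by rewrite !in_order_complex sA => -[/andP[_ ->] ->].
have sf2 : simplicial_chain (order_complex B) k.+1 f2.
  move=> s; rewrite ffunE; case: ifPn; rewrite ?eqxx // => /negPf sA /sf.
  rewrite !in_order_complex => -[/andP[sU sc] ->].
  by have := cover s sc sU; rewrite sA sc /= => ->.
have ef12 : boundary f1 = - boundary f2.
  by apply/eqP; rewrite -addr_eq0 -boundaryD -ef bf.
have [||h sh bh] := hAB (boundary f1).
- move=> s fs; have [sA ->] := simplicial_chain_boundary sf1 fs.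
  have [|sB _] := simplicial_chain_boundary sf2 (_ : boundary f2 s != 0).
    by move: fs; rewrite ef12 ffunE oppr_eq0.
  by move: sA sB; rewrite !in_order_complex subsetI => /andP[-> ->] /andP[->].
- by apply: boundaryK => s /sf1[]; rewrite in_order_complex => /andP[].
have shA := simplicial_chainS (subsetIl A B) sh.
have shB := simplicial_chainS (subsetIr A B) sh.
have [||g1 sg1 bg1] := hA (f1 - h).
- exact/simplicial_chainD/simplicial_chainN.
- by rewrite boundaryD boundaryN bh subrr.
have [||g2 sg2 bg2] := hB (f2 + h).
- exact: simplicial_chainD.
- by rewrite boundaryD bh ef12 subrr.
exists (g1 + g2).
  by apply: simplicial_chainD; [apply: simplicial_chainS sg1|apply: simplicial_chainS sg2].
by rewrite boundaryD bg1 bg2 ef addrA addrAC subrK.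
Qed.

(** In degree -1 only the empty face carries chains, and it belongs to both complexes. *)
Lemma homology_vanishes0S A B : A \subset B ->
  homology_vanishes R (order_complex A) 0 -> homology_vanishes R (order_complex B) 0.
Proof.
move=> AB hA f sf bf; have [|g sg <-] := hA f _ bf; last first.
  by exists g => //; apply: simplicial_chainS sg.
move=> s /sf[]; rewrite !in_order_complex => /andP[_ ->] /eqP.
by rewrite cards_eq0 => /eqP->; rewrite sub0set cards0.
Qed.

End Chains.

(** * Graded totally semimodular bounded posets *)

Section Semimodular.
Variables (d : Order.disp_t) (P : finTBPOrderType d) (rk : P -> nat).
Implicit Types (x y z u v w a b : P) (r c t : seq P) (A F : {set P}).

Hypothesis rk_lt : forall x y, x < y -> (rk x < rk y)%N.
Hypothesis rk_covers : forall x y, covers x y -> rk y = (rk x).+1.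
Hypothesis semimodular : forall z u v y,
  covers z u -> covers z v -> u != v -> u <= y -> v <= y ->
  exists w, [/\ covers u w, covers v w & w <= y].

Lemma covers_lt x y : covers x y -> x < y.
Proof. by case/andP. Qed.

Lemma exists_cover x y : x < y -> exists2 a, covers x a & a <= y.
Proof.
move=> xy; have h0 : (x < y) && (y <= y) by rewrite xy lexx.
case: (@arg_minnP _ y [pred z | x < z <= y] rk h0) => a /andP[xa ay] amin.
exists a => //; rewrite /covers xa; apply/forallP => z; apply/negP => /andP[xz za].
by have := rk_lt za; rewrite ltnNge amin //= xz (le_trans (ltW za)).
Qed.

Lemma rk_path x c : path (@covers _ P) x c -> rk (last x c) = (rk x + size c)%N.
Proof.
elim: c x => [|b c IH] x /=; first by rewrite addn0.
by case/andP=> /rk_covers xb /IH->; rewrite xb addSnnS.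
Qed.

Lemma path_covers_le x c : path (@covers _ P) x c -> x <= last x c.
Proof.
by elim: c x => //= b c IH x /andP[/covers_lt/ltW xb /IH]; apply: le_trans.
Qed.

Lemma semimodular_pure : pure_poset P.
Proof.
move=> m m' /andP[/rk_path p /eqP l] /andP[/rk_path p' /eqP l'].
by apply: (@addnI (rk \bot)); rewrite -p -p' l l'.
Qed.

(** * The chain labelling and its unique increasing chains *)

Section Label.
Local Open Scope ring_scope.

(* The root [r] is read backwards: [label r b] labels the edge from [head \bot r] to [b].
   The elements that cover an atom preceding [x] come before the others, with labels smaller
   than that of [x]. *)
Fixpoint label (r : seq P) (b : P) : int :=
  if r is x :: r' then
    if [exists a, [&& covers (head \bot r') a, label r' a < label r' x & covers a b]]
    then label r' x - (enum_rank b).+1%:Z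
    else label r' x + (enum_rank b).+1%:Z
  else (enum_rank b).+1%:Z.

(** The offsets [(enum_rank b).+1] are positive, so labels below that of [x] never meet those above
    it. This makes the atom of least label unique. *)
Lemma label_inj r : injective (label r).
Proof.
have rank_inj b b' : (enum_rank b : nat) = enum_rank b' -> b = b'.
  by move=> e; apply/enum_rank_inj/val_inj.
case: r => [|x r] b b' /=; first by move=> [/rank_inj].
by do 2!case: ifP => _; move=> e; apply: rank_inj; move: e;
  move: (label r x) (nat_of_ord (enum_rank b)) (nat_of_ord (enum_rank b')) => l i j; lia.
Qed.

Fixpoint labels r c : seq int :=
  if c is b :: c' then label r b :: labels (b :: r) c' else [::].

Definition chain_label (m : seq P) (i : nat) : int :=
  label (rev (take i m)) (nth \bot m i).

Lemma rooted_labelsE r c t : rooted_labels chain_label r c t = labels (rev r) c.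
Proof.
elim: c r => [|b c IH] r //=; rewrite /rooted_labels /= {1}/chain_label.
rewrite take_size_cat // nth_cat ltnn subnn /=; congr (_ :: _).
have := IH (rcons r b); rewrite rev_rcons => <-.
by rewrite /rooted_labels size_rcons cat_rcons.
Qed.

(** Always step to the atom of least label. The last clause is what uniqueness asks of the induction
    hypothesis; the default [a] in [head a c] makes it hold for the empty chain. *)
Lemma greedy_chain r x y : head \bot r = x -> (x <= y)%O ->
  exists c, [/\ unrefinable x y c, sorted <%O (labels r c),
    forall c', unrefinable x y c' -> sorted <%O (labels r c') -> c' = c,
    forall c', unrefinable x y c' -> c' != c ->
      ((labels r c : seqlexi int) < labels r c')%O
  & forall a, covers x a -> (a <= y)%O -> label r (head a c) <= label r a].
Proof.
have nil_of_unref x1 c' : unrefinable x1 x1 c' -> c' = [::].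
  case: c' => // b c' /andP[/= /andP[/covers_lt x1b /path_covers_le bl] /eqP e].
  by rewrite e (lt_geF x1b) in bl.
have [n] := ubnP (rk y - rk x); elim: n r x => // n IH r x rn hr.
rewrite le_eqVlt => /predU1P[<-|xy].
  exists [::]; split=> //; first by rewrite /unrefinable /= eqxx.
  by move=> c' /nil_of_unref.
  by move=> c' /nil_of_unref-> /eqP.
have [a0 xa0 a0y] := exists_cover xy.
have h0 : covers x a0 && (a0 <= y)%O by rewrite xa0.
have [a /andP[xa ay] amin] :=
  @arg_minP _ _ _ a0 [pred a | covers x a && (a <= y)%O] (label r) h0.
have rkb b : covers x b -> (b <= y)%O -> (rk y - rk b < n)%N.
  move=> /rk_covers xb _; have := rk_lt xy; move: rn; rewrite xb ltnS => h1 h2.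
  by apply: leq_trans h1; rewrite ltn_sub2l.
have IHa b (xb : covers x b) (by_ : (b <= y)%O) :=
  IH (b :: r) b (rkb b xb by_) erefl by_.
have [c [uc sc cuniq clex cmin]] := IHa a xa ay.
have split_unref c' : unrefinable x y c' ->
    exists b c1, [/\ c' = b :: c1, covers x b, (b <= y)%O & unrefinable b y c1].
  case: c' => [/andP[_ /eqP e]|b c1 /andP[/= /andP[xb pb] /eqP e]].
    by rewrite -e ltxx in xy.
  exists b, c1; split=> //; first by rewrite -e path_covers_le.
  by rewrite /unrefinable pb e eqxx.
have label_lt b : covers x b -> (b <= y)%O -> b != a -> label r a < label r b.
  move=> xb by_ ba; rewrite lt_neqAle amin ?andbT /= ?xb //.
  by rewrite (inj_eq (@label_inj r)) eq_sym.
exists (a :: c); split.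
- by rewrite /unrefinable /= xa; apply: uc.
- case: c uc sc {cuniq clex cmin} => //= b c /andP[/= /andP[ab pb] /eqP e] ->.
  (* An atom [a'] preceding [a] and covered by [b] would lie below [y], against the choice of [a];
     so the label of [b] exceeds that of [a]. *)
  rewrite andbT; case: ifPn => [/existsP[a' /and3P[xa' a'a a'b]]|_].
    have : (a' <= y)%O.
      by apply: le_trans (ltW (covers_lt a'b)) _; rewrite -e path_covers_le.
    by move=> a'y; have := amin a'; rewrite /= -{1}hr xa' a'y leNgt a'a => /(_ isT).
  by rewrite ltrDl.
- move=> c' /split_unref[b [c1 [-> xb by_ ub]]] sb.
  have [ba|ba] := eqVneq b a.
    by subst b; congr (_ :: _); apply: cuniq => //; apply: path_sorted sb.
  (* For a first step [b] other than [a], the tail must be the greedy chain above [b], whose first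
     label is minimal. Semimodularity gives [w] covering [a] and [b]; since [a] precedes [b], the
     label of [w] is below that of [b], so the chain descends after [b]. *)
  have [c2 [uc2 sc2 c2uniq _ c2min]] := IHa b xb by_.
  have e12 : c1 = c2 by apply: c2uniq => //; apply: path_sorted sb.
  subst c1; have ab : a != b by rewrite eq_sym.
  have [w [aw bw wy]] := semimodular xa xb ab ay by_.
  have lw : label (b :: r) w < label r b.
    rewrite /= ifT ?ltrBlDr ?ltrDl //; apply/existsP; exists a.
    by rewrite hr xa label_lt.
  case: c2 ub sb {uc2 sc2 c2uniq} c2min => [/andP[_ /eqP/= e]|b' c2 _ sb] c2min.
    by have := lt_geF (covers_lt bw); rewrite e wy.
  have := c2min w bw wy; rewrite [head _ _]/= => lb'.
  have /andP[lbb' _] := sb.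
  by have := lt_trans lbb' (le_lt_trans lb' lw); rewrite ltxx.
- move=> c' /split_unref[b [c1 [-> xb by_ ub]]].
  have [ba|ba] := eqVneq b a; last first.
    move=> _; rewrite [X in (X < _)%O]/= [X in (_ < X)%O]/=.
    by rewrite neqhead_ltxiE ?lt_eqF ?label_lt.
  subst b => ne; rewrite [X in (X < _)%O]/= [X in (_ < X)%O]/= eqhead_ltxiE.
  by apply: clex => //; apply: contraNneq ne => ->; rewrite eqxx.
- by move=> b xb by_ /=; apply: amin; rewrite /= xb.
Qed.
End Label.

Lemma semimodular_CL_shellable : CL_shellable P.
Proof.
split; first exact: semimodular_pure.
exists _, int, chain_label; split.
  (* The label of edge [i] uses only the first [i.+1] elements of the chain. *)
  move=> m m' k _ _ _ _ ek i ik; rewrite /chain_label.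
  by rewrite -(nth_take _ ik) ek nth_take // -(take_takel m (ltnW ik)) ek take_takel // ltnW.
move=> x y r t xy /andP[_ /eqP rx] _.
have hr : head \bot (rev r) = x.
  by case/lastP: r rx => [|r z] //=; rewrite last_rcons rev_rcons.
have [c [uc sc cuniq clex _]] := greedy_chain hr xy.
exists c; split=> // [|c' uc'|c' uc' nc]; rewrite !rooted_labelsE //.
  exact: cuniq.
exact: clex.
Qed.


(** * Homology of the open intervals *)

Definition upper_part A y : {set P} :=
  [set z | (z < y) && [exists a in A, a <= z]].

Lemma in_upper_part A y z :
  reflect (z < y /\ exists2 a, a \in A & a <= z) (z \in upper_part A y).
Proof.
rewrite inE; apply: (iffP andP) => -[zy] => [/exists_inP|h]; split=> //.
exact/exists_inP.
Qed.

Lemma upper_partS (A B : {set P}) y : A \subset B ->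
  upper_part A y \subset upper_part B y.
Proof.
move=> /subsetP AB; apply/subsetP => z /in_upper_part[zy [a /AB aB az]].
by apply/in_upper_part; split=> //; exists a.
Qed.

Lemma upper_part1_homology_vanishes (R : comNzRingType) k a y : a < y ->
  homology_vanishes R (order_complex (upper_part [set a] y)) k.
Proof.
move=> ay; apply: (@homology_vanishes_cone _ _ _ _ a).
  by apply/in_upper_part; split=> //; exists a; rewrite ?set11.
by move=> z /in_upper_part[_ [_ /set1P->]].
Qed.

(** Induction on [k], then on the number of atoms in [A]. The rank bound keeps each atom strictly
    below [y] and passes to [[a, y]] with [k] lowered by one. *)
Lemma upper_part_homology_vanishes (R : comNzRingType) k x y A :
    A != set0 -> (forall a, a \in A -> covers x a /\ a <= y) ->
    (k.+1 + rk x < rk y)%N ->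
  homology_vanishes R (order_complex (upper_part A y)) k.
Proof.
have lt_y x1 A1 k1 a : (forall a, a \in A1 -> covers x1 a /\ a <= y) ->
    (k1.+1 + rk x1 < rk y)%N -> a \in A1 -> a < y.
  move=> xA rxy /xA[/rk_covers ra ay]; rewrite lt_neqAle ay andbT.
  by apply: contraTneq rxy => <-; rewrite ra; lia.
elim: k x A => [|k IHk] x A.
  move=> /set0Pn[a aA] xA rxy; have ay := lt_y _ _ _ _ xA rxy aA.
  have sa : [set a] \subset A by rewrite sub1set.
  apply: (homology_vanishes0S (upper_partS y sa)).
  exact: upper_part1_homology_vanishes.
have [m] := ubnP #|A|; elim: m A => // m IHm A cA A0 xA rxy.
have /set0Pn[a aA] := A0; have [xa ay] := xA a aA.
have hcone := @upper_part1_homology_vanishes R k.+1 _ _ (lt_y _ _ _ _ xA rxy aA).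
have [A'0|A'0] := eqVneq (A :\ a) set0.
  by rewrite -(setD1K aA) A'0 setU0.
have sa : [set a] \subset A by rewrite sub1set.
apply: (Mayer_Vietoris (upper_partS y (subsetDl A [set a]))
  (upper_partS y sa)) => //.
(* If [z] in the chain is above no other atom of [A], then [a] is the only one below it. Any [z']
   above [z] is above [a], and any [z'] below [z] is above an atom of [A], which must be [a]. *)
- move=> s /is_chainP sc /subsetP sA.
  apply/orP; have [|/subsetPn[z zs zA]] := boolP (s \subset _); first by left.
  right; apply/subsetP => z' zs'; have [z'y [b bA bz']] := in_upper_part _ _ _ (sA _ zs').
  have [zy [c cA' cz]] := in_upper_part _ _ _ (sA _ zs).
  have az u : u \in A -> u <= z -> u = a.
    move=> uA uz; apply/eqP; apply: contraNT zA => ua; apply/in_upper_part.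
    by split=> //; exists u => //; rewrite !inE ua.
  apply/in_upper_part; split=> //; exists a; rewrite ?set11 //.
  have /orP[zz'|z'z] := sc _ _ zs zs'.
    by rewrite -(az c cA' cz) (le_trans cz).
  by rewrite -(az b bA (le_trans bz' z'z)).
- apply: IHm => //; first by move: cA; rewrite (cardsD1 a) aA.
  by move=> b /setD1P[_ /xA].
(* By semimodularity, an element above [a] and another atom of [A] is above a common cover of both,
   so these atoms of [[a, y]] generate the intersection. *)
pose F := [set w | [&& covers a w, w <= y & [exists b in A :\ a, b <= w]]].
have inF b z : b \in A :\ a -> a <= z -> b <= z -> z <= y ->
    exists2 w, w \in F & w <= z.
  move=> bA az bz zy; have [ba bA'] := setD1P bA; have [xb _] := xA b bA'.
  have [|w [aw bw wz]] := semimodular xa xb _ az bz; first by rewrite eq_sym.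
  exists w; rewrite // inE aw (le_trans wz zy); apply/exists_inP.
  by exists b => //; apply/ltW/covers_lt.
have -> : upper_part (A :\ a) y :&: upper_part [set a] y =
    upper_part F y.
  apply/setP => z; apply/setIP/in_upper_part.
    case=> /in_upper_part[zy [b bA bz]] /in_upper_part[_ [_ /set1P-> az]].
    by split=> //; have [w wF wz] := inF b z bA az bz (ltW zy); exists w.
  case=> zy [w]; rewrite inE => /and3P[aw wy /exists_inP[b bA bw]] wz.
  split; apply/in_upper_part; split=> //; first by exists b => //; apply: le_trans wz.
  by exists a; rewrite ?set11 // (le_trans _ wz) // ltW // covers_lt.
apply: (IHk a); last by rewrite (rk_covers xa) addnS -addSn.
  have /set0Pn[b bA] := A'0; have [_ bA'] := setD1P bA.
  have [w wF _] := inF b y bA ay (proj2 (xA b bA')) (lexx y).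
  by apply/set0Pn; exists w.
by move=> w; rewrite inE => /and3P[].
Qed.

Lemma interval_length_le x y : (interval_length x y <= rk y - rk x)%N.
Proof.
apply/bigmax_leqP => s /andP[/is_chainP sc /subsetP sxy].
have u : uniq [seq rk z | z <- enum s].
  rewrite map_inj_in_uniq ?enum_uniq // => v w; rewrite !mem_enum => vs ws e.
  by have := sc _ _ vs ws; rewrite /Order.comparable !le_eqVlt => /orP[] /orP[/eqP//|/rk_lt];
    rewrite e ltnn.
have rk_le v w : v <= w -> (rk v <= rk w)%N.
  by rewrite le_eqVlt => /predU1P[->//|/rk_lt/ltnW].
have := uniq_leq_size u (s2 := iota (rk x) (rk y - rk x).+1).
rewrite size_map -cardE size_iota => h.
have : (#|s| <= (rk y - rk x).+1)%N.
  apply: h => _ /mapP[z + ->]; rewrite mem_enum => /sxy; rewrite inE => /andP[xz zy].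
  by rewrite mem_iota; have := rk_le _ _ xz; have := rk_le _ _ zy; lia.
by lia.
Qed.

(** Adding both end points to the chain gives a chain of [[x, y]] with two more elements. *)
Lemma chain_interval_length x y s : x < y ->
  s \in order_complex (open_interval x y) -> (#|s|.+1 <= interval_length x y)%N.
Proof.
move=> xy; rewrite in_order_complex => /andP[/subsetP sxy /is_chainP sc].
have sP z : z \in s -> x < z /\ z < y by move/sxy; rewrite inE => /andP.
have ys : y \notin s by apply/negP => /sP[_]; rewrite ltxx.
have xs : x \notin y |: s.
  by rewrite !inE negb_or (lt_eqF xy); apply/negP => /sP[]; rewrite ltxx.
have := @leq_bigmax_cond _ [pred t : {set P} | is_chain t && (t \subset [set z | x <= z <= y])]
  (fun t : {set P} => #|t|.-1) (x |: (y |: s)).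
rewrite /= !cardsU1 xs ys; apply; apply/andP; split.
  have bd v : v \in x |: (y |: s) -> x <= v <= y.
    case/setU1P => [->|/setU1P[->|/sP[xv vy]]]; rewrite ?lexx ?ltW //.
  apply/is_chainP => v w hv hw; have /andP[xv vy] := bd v hv; have /andP[xw wy] := bd w hw.
  move: hv hw; rewrite /Order.comparable.
  case/setU1P => [->|/setU1P[->|vs]]; rewrite ?xw ?wy ?orbT //.
  by case/setU1P => [->|/setU1P[->|ws]]; rewrite ?xv ?vy ?orbT //; apply: sc.
apply/subsetP => v; rewrite inE.
by case/setU1P => [->|/setU1P[->|/sP[xv vy]]]; rewrite ?lexx ?ltW.
Qed.

Lemma semimodular_Cohen_Macaulay (R : comNzRingType) : Cohen_Macaulay_over P R.
Proof.
move=> x y xy k; move/eqP; rewrite neq_ltn => /orP[kl|kl].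
  pose A := [set a | covers x a && (a <= y)].
  have -> : open_interval x y = upper_part A y.
    apply/setP => z; rewrite inE; apply/andP/in_upper_part => [[xz zy]|[zy [a]]].
      have [a xa az] := exists_cover xz; split=> //; exists a => //.
      by rewrite inE xa (le_trans az (ltW zy)).
    by rewrite inE => /andP[/covers_lt xa _] /(lt_le_trans xa).
  apply: (upper_part_homology_vanishes (x := x)).
  - have [a xa ay] := exists_cover xy; apply/set0Pn; exists a.
    by rewrite inE xa.
  - by move=> a; rewrite inE => /andP.
  by have := interval_length_le x y; lia.
(* Above the top degree no face has [k] vertices, so [f] is zero. *)
move=> f sf bf; exists 0%R; first by move=> s; rewrite ffunE eqxx.
rewrite boundary0; apply/ffunP => s; rewrite ffunE; apply/esym/eqP.
apply: contraLR kl => /sf[/(chain_interval_length xy) + sk].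
by rewrite sk -leqNgt.
Qed.

End Semimodular.

(** * Pointed partitions as idempotent self-maps of ['I_n] *)

Section Idempotents.
Variable n : nat.
Implicit Types (p q : pointed_partition n) (f : 'I_n -> 'I_n) (i j : 'I_n).

Definition rep p i := transversal_repr i (points p) (pblock (blocks p) i).

Lemma pp_transversal p : is_transversal (points p) (blocks p) [set: 'I_n].
Proof. by case: p. Qed.

Lemma blocks_trivIset p : trivIset (blocks p).
Proof. by case/and3P: (blocks_partition p). Qed.

Lemma mem_cover_blocks p i : i \in cover (blocks p).
Proof. by rewrite (cover_partition (blocks_partition p)) inE. Qed.

Lemma pblock_blocks p i : pblock (blocks p) i \in blocks p.
Proof. exact/pblock_mem/mem_cover_blocks. Qed.

Lemma rep_points p i : rep p i \in points p.
Proof. exact: (repr_mem_transversal (pp_transversal p) i (pblock_blocks p i)). Qed.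

Lemma rep_pblock p i : pblock (blocks p) (rep p i) = pblock (blocks p) i.
Proof. exact: (transversal_reprK (pp_transversal p) i (pblock_blocks p i)). Qed.

Lemma rep_fixed p i : i \in points p -> rep p i = i.
Proof. exact: (pblockK (pp_transversal p)). Qed.

Lemma rep_idem p i : rep p (rep p i) = rep p i.
Proof. exact/rep_fixed/rep_points. Qed.

Lemma mem_points p i : (i \in points p) = (rep p i == i).
Proof. by apply/idP/eqP => [/rep_fixed // | <-]; apply: rep_points. Qed.

Lemma eq_rep p i j :
  (rep p i == rep p j) = (pblock (blocks p) i == pblock (blocks p) j).
Proof.
apply/eqP/eqP => [eqr|eqB]; first by rewrite -rep_pblock eqr rep_pblock.
apply: (pblock_inj (pp_transversal p)); rewrite ?rep_points //.
by rewrite !rep_pblock.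
Qed.

(** The first equations encode refinement of the blocks, the second ones the inclusion of the points
    of [q] in those of [p]. *)
Lemma rep_leP p q :
  reflect ((forall i, rep q (rep p i) = rep q i) /\
           (forall i, rep p (rep q i) = rep q i)) (p <= q).
Proof.
apply: (iffP andP) => [[/refinesP ref /subsetP sub] | [qp pq]].
  split=> i; last by apply/rep_fixed/sub/rep_points.
  have [C hC /subsetP BC] := ref _ (pblock_blocks p i).
  have mC j : j \in pblock (blocks p) i -> pblock (blocks q) j = C.
    by move/BC; apply: def_pblock (blocks_trivIset q) hC.
  apply/eqP; rewrite eq_rep !mC ?mem_pblock ?mem_cover_blocks //.
  by rewrite -rep_pblock mem_pblock mem_cover_blocks.
split; last first.
  by apply/subsetP => i; rewrite !mem_points => /eqP <-; rewrite pq.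
apply/refinesP => B hB.
have /set0Pn[b bB] : B != set0.
  by apply: contraTneq hB => ->; case/and3P: (blocks_partition p).
exists (pblock (blocks q) b); first exact: pblock_blocks.
apply/subsetP => i iB.
rewrite -(eq_pblock _ (blocks_trivIset q)) ?mem_cover_blocks //.
rewrite -eq_rep -(qp b) -(qp i); apply/eqP; congr (rep q _); apply/eqP.
by rewrite eq_rep !(def_pblock (blocks_trivIset p) hB).
Qed.

Lemma rep_inj p q : rep p =1 rep q -> p = q.
Proof.
move=> e; apply/eqP; rewrite eq_le; apply/andP.
by split; apply/rep_leP; split=> i; rewrite ?e ?rep_idem // -e rep_idem.
Qed.

Lemma mem_preim_partition f i j :
  (j \in pblock (preim_partition f [set: 'I_n]) i) = (f i == f j).
Proof.
by rewrite pblock_equivalence_partition ?inE //; split=> // /eqP->.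
Qed.

(** By idempotence, the common value of [f] on a fibre is the only fixed point in that fibre. *)
Fact idem_transversal f (idf : forall i, f (f i) = f i) :
  is_transversal [set i | f i == i] (preim_partition f [set: 'I_n])
    [set: 'I_n].
Proof.
have partf := preim_partitionP f [set: 'I_n].
rewrite /is_transversal partf subsetT /=; apply/forall_inP => B hB.
have [_ tr ne] := and3P partf.
have /set0Pn[b bB] : B != set0 by apply: contraTneq hB => ->.
apply/cards1P; exists (f b); apply/setP => i; rewrite !inE.
rewrite -(def_pblock tr hB bB) mem_preim_partition.
apply/andP/eqP => [[/eqP fi /eqP ->] // | ->].
by rewrite idf !eqxx.
Qed.

Definition pp_of_idem f (idf : forall i, f (f i) = f i) : pointed_partition n :=
  @PointedPartition n (_, _) (idem_transversal idf).

Lemma rep_pp_of_idem f idf : rep (@pp_of_idem f idf) =1 f.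
Proof.
move=> i; set p := pp_of_idem _.
have := rep_points p i; rewrite {1}/points /= inE => /eqP <-.
have: rep p i \in pblock (blocks p) i.
  by rewrite -rep_pblock mem_pblock mem_cover_blocks.
by rewrite mem_preim_partition => /eqP <-.
Qed.

Definition rank p := (n - #|points p|)%N.

Lemma card_points p : (#|points p| <= n)%N.
Proof. by rewrite -[leqRHS]card_ord max_card. Qed.

(** If [p] and [q] had the same points, [rep q] would fix every [rep p i], and
    [rep q (rep p i) = rep q i] would identify the two maps. *)
Lemma rank_lt p q : p < q -> (rank p < rank q)%N.
Proof.
rewrite lt_neqAle => /andP[neq pq].
have [qp sub] : (forall i, rep q (rep p i) = rep q i) /\ points q \subset points p.
  by have /rep_leP[] := pq; case/andP: pq.
have card_lt : (#|points q| < #|points p|)%N.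
  rewrite proper_card // properEneq sub andbT; apply: contraNneq neq => epts.
  apply/eqP/rep_inj => i.
  by rewrite -[RHS]qp; apply/esym/rep_fixed; rewrite epts rep_points.
by rewrite /rank ltn_sub2l // (leq_trans card_lt) ?card_points.
Qed.

(** * Merging the block of [b] into that of [a], which stays the point *)

Section Merge.
Variables (p : pointed_partition n) (b a : 'I_n).
Hypotheses (pb : rep p b = b) (pa : rep p a = a) (ab : a != b).

Let m i := if rep p i == b then a else rep p i.

Fact merge_idem i : m (m i) = m i.
Proof.
rewrite /m; case: (eqVneq (rep p i) b) => [_|ib].
  by rewrite pa (negPf ab).
by rewrite rep_idem (negPf ib).
Qed.

Definition merge := pp_of_idem merge_idem.

Lemma rep_merge i : rep merge i = if rep p i == b then a else rep p i.
Proof. by rewrite rep_pp_of_idem. Qed.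

Lemma le_merge : p <= merge.
Proof.
apply/rep_leP; split=> i; rewrite !rep_merge ?rep_idem //.
by case: ifP; rewrite ?rep_idem ?pa.
Qed.

Lemma points_merge : points merge = points p :\ b.
apply/setP => i; rewrite in_setD1.
rewrite !mem_points rep_merge.
have [->|ib] := eqVneq i b; first by rewrite pb eqxx (negPf ab).
have [e|//] := eqVneq (rep p i) b; rewrite e [b == i]eq_sym (negPf ib).
by apply/eqP => ai; case/eqP: ab; rewrite -e -ai pa.
Qed.

(** The condition [rep q b = rep q a] gives the first equations of [rep_leP], and [rep q b != b] the
    second ones, as then no value of [rep q] is [b]. *)
Lemma merge_le q : p <= q -> rep q b = rep q a -> rep q b != b -> merge <= q.
Proof.
case/rep_leP=> qp pq qba qb; apply/rep_leP; split=> i; rewrite rep_merge.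
  by have [ib|_] := eqVneq (rep p i) b; rewrite -[RHS]qp ?ib ?qba.
rewrite pq; have [qi|//] := eqVneq (rep q i) b; case/eqP: qb.
by rewrite -qi rep_idem.
Qed.

Lemma rank_merge : rank merge = (rank p).+1.
Proof.
have bp : b \in points p by rewrite mem_points pb.
have := card_points p; rewrite /rank points_merge (cardsD1 b (points p)) bp.
by move=> h; rewrite -subSn // subSS.
Qed.

End Merge.


Lemma rank_le_eq p q : p <= q -> (rank q <= rank p)%N -> p = q.
Proof.
by rewrite le_eqVlt => /orP[/eqP // | /rank_lt]; rewrite ltnNge => /negPf->.
Qed.

Lemma lt_merge p q : p < q ->
  exists b a (pa : rep p a = a) (ab : a != b), rep p b = b /\ merge pa ab <= q.
Proof.
rewrite lt_neqAle => /andP[neq pq]; have /rep_leP[qp qq] := pq.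
have [i ni] : exists i, rep q i != rep p i.
  apply/existsP; apply: contraNT neq => /existsPn h.
  by apply/eqP/rep_inj => i; apply/esym/eqP; rewrite -[_ == _]negbK h.
have nb : rep q (rep p i) != rep p i by rewrite qp.
(* Here [b] is a point of [p] that [rep q] moves, and [a] is its image, a point of [q] and hence of
   [p]. *)
exists (rep p i), (rep q (rep p i)), (qq _), nb; rewrite rep_idem; split=> //.
by apply: merge_le; rewrite ?rep_idem.
Qed.

Lemma cover_merge p q : p < q -> (rank q <= (rank p).+1)%N ->
  exists b a (pa : rep p a = a) (ab : a != b), rep p b = b /\ q = merge pa ab.
Proof.
move=> /lt_merge[b [a [pa [ab [pb le]]]]] rk; exists b, a, pa, ab; split=> //.
by apply/esym/rank_le_eq; rewrite // rank_merge.
Qed.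

Lemma pp_semimodular z u v y :
  z < u -> (rank u <= (rank z).+1)%N -> z < v -> (rank v <= (rank z).+1)%N ->
  u != v -> u <= y -> v <= y ->
  exists w, [/\ u <= w, v <= w, w <= y & rank w = (rank z).+2].
Proof.
move=> /cover_merge h/h{h}[b [a [za [ab [zb ->{u}]]]]].
move=> /cover_merge h/h{h}[b' [a' [za' [ab' [zb' ->{v}]]]]].
set u := merge za ab; set v := merge za' ab' => neq uy vy.
have zy := le_trans (le_merge za ab) uy.
have ru i : rep z i = i -> rep u i = if i == b then a else i.
  by move=> zi; rewrite rep_merge zi.
have merge_val c e (zc : rep z e = e) (ec : e != c) :
    rep z c = c -> merge zc ec <= y -> rep y c = rep y e /\ rep y c != c.
  move=> zc' /rep_leP[h1 h2]; have rc : rep (merge zc ec) c = e.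
    by rewrite rep_merge zc' eqxx.
  split; first by rewrite -[LHS]h1 rc.
  by apply/eqP => e1; case/eqP: (ec); have := h2 c; rewrite e1 rc.
have [yb yb0] := merge_val b a za ab zb uy.
have [yb' yb0'] := merge_val b' a' za' ab' zb' vy.
have zyi i : rep z (rep y i) = rep y i by case/rep_leP: zy.
(* w sends the points mapped to c by u to e; the last two conditions say that v <= w. *)
suff [c [e [uc ue ec]]] : exists c e, [/\ rep u c = c, rep u e = e, e != c &
    [/\ rep y c = rep y e, rep y c != c,
       (if rep u b' == c then e else rep u b') =
       (if rep u a' == c then e else rep u a') &
       (if rep u b' == c then e else rep u b') != b']].
  case=> yc yc0 wba wb0; exists (merge ue ec).
  have rw := rep_merge ue ec.
  split; rewrite ?le_merge ?(merge_le ue ec) ?rank_merge //.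
  by apply: (merge_le za' ab'); rewrite ?rw // (le_trans (le_merge za ab)) ?le_merge.
have [bb'|bb'] := eqVneq b b'.
  subst b'; have aa' : a != a'.
    apply: contraNneq neq => aa; apply/eqP/rep_inj => i.
    by rewrite !rep_merge aa.
  have ub : rep u b = a by rewrite ru // eqxx.
  have ua : rep u a = a by rewrite ru // (negPf ab).
  have ua' : rep u a' = a' by rewrite ru // (negPf ab').
  (* With [b = b'], [w] must merge [a] with [a']; it keeps [a] as the point if [y] does, and
     otherwise [a']. *)
  have [ya|ya] := eqVneq (rep y a) a.
    exists a', a; rewrite ub ua ua' eqxx (negPf aa').
    by split=> //; split; rewrite // -?yb' ?yb ?ya.
  exists a, a'; rewrite ub ua ua' eqxx [a' == a]eq_sym (negPf aa').
  by split=> //; split; rewrite // -?yb'.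
have ub' : rep u b' = b' by rewrite ru // eq_sym (negPf bb').
have [a'b|a'b] := eqVneq a' b; last first.
  (* As [a'] is still a point of [u], repeat on [u] the redirection of [b'] to [a']. *)
  have ua' : rep u a' = a' by rewrite ru // (negPf a'b).
  by exists b', a'; rewrite ub' ua' eqxx (negPf ab').
subst a'; have ub : rep u b = a by rewrite ru // eqxx.
have ua : rep u a = a by rewrite ru // (negPf ab).
have [a_b'|a_b'] := eqVneq a b'; last first.
  by exists b', a; rewrite ub' ub ua eqxx (negPf a_b'); split=> //; split; rewrite // yb'.
(* Now [u] sends [b] to [b'] and [v] sends [b'] to [b], so neither can be a point of [w]; the point
   of [y] in their common block serves instead. *)
have uyb' : rep u (rep y b') = rep y b' by rewrite ru // yb' (negPf yb0).
by exists b', (rep y b'); rewrite ub' ub uyb' a_b' eqxx rep_idem.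
Qed.

End Idempotents.

(** * Rank and semimodularity in the interval below [a] *)

Section LowerIntervalSemimodular.
Variables (n : nat) (a : pointed_partition n).
Implicit Types (x y z u v : lower_interval a).

Let rk x := rank (val x).

Lemma lower_rank_lt x y : x < y -> (rk x < rk y)%N.
Proof. by move=> xy; apply: rank_lt; rewrite lt_val. Qed.

Lemma mem_lower (p : pointed_partition n) y : p <= val y -> \bot <= p <= a.
Proof. by move=> py; rewrite le0x (le_trans py) //; case/andP: (valP y). Qed.

(** Some merge of [x] lies below [y], hence in the interval, and its rank is one more than that of
    [x]; as nothing lies strictly between, it is [y]. *)
Lemma lower_rank_covers x y : covers x y -> rk y = (rk x).+1.
Proof.
case/andP=> xy /forallP nxy.
have [b [c [xc [cb [xb my]]]]] : exists b c (xc : rep (val x) c = c) (cb : c != b),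
    rep (val x) b = b /\ merge xc cb <= val y by apply: lt_merge; rewrite lt_val.
pose z : lower_interval a := Sub (merge xc cb) (mem_lower my).
have zy : z <= y by rewrite -Order.le_val SubK.
have rz : rk z = (rk x).+1 by rewrite /rk SubK rank_merge.
have xz : x < z.
  rewrite lt_neqAle -Order.le_val SubK le_merge andbT.
  by apply/eqP => e; move: rz; rewrite -e => /n_Sn.
have := nxy z; rewrite xz /= lt_neqAle zy andbT negbK => /eqP <-.
exact: rz.
Qed.

Lemma covers_lower_rank x y : x <= y -> rk y = (rk x).+1 -> covers x y.
Proof.
move=> xy rxy; rewrite /covers lt_neqAle xy andbT; apply/andP; split.
  by apply/eqP => e; move: rxy; rewrite e => /n_Sn.
apply/forallP => z; apply/negP => /andP[/lower_rank_lt xz /lower_rank_lt].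
by rewrite rxy ltnS leqNgt xz.
Qed.

Lemma lower_semimodular z u v y :
  covers z u -> covers z v -> u != v -> u <= y -> v <= y ->
  exists w, [/\ covers u w, covers v w & w <= y].
Proof.
move=> zu zv uv uy vy; have ru := lower_rank_covers zu; have rv := lower_rank_covers zv.
have [w [uw vw wy rw]] : exists w, [/\ val u <= w, val v <= w, w <= val y &
    rank w = (rk z).+2].
  apply: pp_semimodular; rewrite ?lt_val ?Order.le_val ?(inj_eq val_inj) //.
  - exact: covers_lt.
  - by rewrite -ru.
  - exact: covers_lt.
  - by rewrite -rv.
pose w' : lower_interval a := Sub w (mem_lower wy).
have ew : val w' = w by [].
have rw' : rk w' = (rk z).+2 by rewrite /rk ew.
exists w'; split.
- by apply: covers_lower_rank; [rewrite -Order.le_val ew | rewrite rw' ru].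
- by apply: covers_lower_rank; [rewrite -Order.le_val ew | rewrite rw' rv].
- by rewrite -Order.le_val ew.
Qed.

End LowerIntervalSemimodular.

Theorem theorem1p11 (n : nat) (n_ge1 : (1 <= n)%N)
    (a : pointed_partition n) (a_max : maximal a) :
  CL_shellable (lower_interval a) /\ Cohen_Macaulay (lower_interval a).
Proof.
split; first exact: semimodular_CL_shellable (@lower_rank_lt _ a)
  (@lower_rank_covers _ a) (@lower_semimodular _ a).
by split=> [|K]; apply: semimodular_Cohen_Macaulay (@lower_rank_lt _ a)
  (@lower_rank_covers _ a) (@lower_semimodular _ a) _.
Qed.
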